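(* Let $0<q<1$, $a,b\in q^{\mathbb{Z}}$, $a<b$, and $n\in\mathbb{N}$. Then, for any $x\in[q^{-1}a,b]$, the following inequalities hold: $$e^x_q\ \ge\ \sum_{k=0}^{n-1}\frac{e_q^{a}}{[k]!}(x-a)^{k}_{q}+\frac{1}{(q^{-1}a-a)^n_q}\left(e^{q^{-1}a}_q-\sum_{k=0}^{n-1}\frac{e_q^{a}}{[k]!}(q^{-1}a-a)^{k}_{q}\right)(x-a)_q^n,$$ $$e^x_q\ \le\ \sum_{k=0}^{n-1}\frac{e_q^{a}}{[k]!}(x-a)^{k}_{q}+\frac{1}{(b-a)^n_q}\left(e^{b}_q-\sum_{k=0}^{n-1}\frac{e_q^{a}}{[k]!}(b-a)^{k}_{q}\right)(x-a)_q^n.$$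
   Context: Here $q^{\mathbb{Z}}=\{q^m:m\in\mathbb{Z}\}$, $\mathbb{N}=\{1,2,3,\dots\}$, and all intervals are time scale intervals on the time scale $\mathbb{T}=\overline{q^{\mathbb{Z}}}=q^{\mathbb{Z}}\cup\{0\}$, i.e. $[q^{-1}a,b]=\{x\in\mathbb{T}:q^{-1}a\le x\le b\}$. For a real number $\alpha$, $[\alpha]:=\frac{q^\alpha-1}{q-1}$; $[0]!:=1$ and $[n]!:=[n][n-1]\cdots[2][1]$ for $n\in\mathbb{N}$; $(x-a)^0_q:=1$ and $(x-a)^n_q:=(x-a)(x-qa)\cdots(x-q^{n-1}a)$ for $n\in\mathbb{N}$ (so $(q^{-1}a-a)^n_q$ and $(b-a)^n_q$ denote this expression evaluated at $x=q^{-1}a$ and $x=b$). The $q$-exponential function is $e^x_q=\sum_{k=0}^{+\infty}\frac{x^k}{[k]!}$.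
   Formalization: It is additionally assumed that the series defining e_q^b converges (i.e. b < 1/(1-q)); for larger b in q^Z the series diverges and e_q^b in the second inequality is undefined. *)

(* Defs.v *)
From HB Require Import structures.
From mathcomp Require Import all_boot all_order all_algebra.
From mathcomp Require Import all_classical all_reals all_analysis.
Set Implicit Arguments.
Unset Strict Implicit.
Unset Printing Implicit Defensive.
Import Order.TTheory GRing.Theory Num.Theory numFieldNormedType.Exports.
Local Open Scope classical_set_scope.
Local Open Scope ring_scope.

Definition qZ (R : realType) (q : R) : set R := range (fun m : int => q ^ m).

(* For 0 < q < 1 this is qZ q together with the point 0. *)
Definition timescale (R : realType) (q : R) : set R := closure (qZ q).

Definition timescale_itv (R : realType) (q c d : R) : set R :=
  [set x | timescale q x /\ c <= x <= d].

Definition qnum (R : realType) (q alpha : R) : R := (q `^ alpha - 1) / (q - 1).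

Definition qfact (R : realType) (q : R) (n : nat) : R :=
  \prod_(1 <= k < n.+1) qnum q k%:R.

(* (x - a)^n_q = (x - a)(x - q a)...(x - q^(n-1) a) *)
Definition qpow (R : realType) (q x a : R) (n : nat) : R :=
  \prod_(0 <= j < n) (x - q ^+ j * a).

Definition qexp_term (R : realType) (q x : R) : R^nat :=
  fun k => x ^+ k / qfact q k.

(* For 0 < q < 1 the series has radius of convergence 1 / (1 - q); outside its
   domain of convergence qexp takes the unspecified value of a divergent limit. *)
Definition qexp (R : realType) (q x : R) : R := limn (series (qexp_term q x)).

(* Main.v *)
Require Import Defs.
From HB Require Import structures.
From mathcomp Require Import all_boot all_order all_algebra.
From mathcomp Require Import ring.
From mathcomp Require Import all_classical all_reals all_analysis.
Set Implicit Arguments.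
Unset Strict Implicit.
Unset Printing Implicit Defensive.
Import Order.TTheory GRing.Theory Num.Theory numFieldNormedType.Exports.
Local Open Scope classical_set_scope.
Local Open Scope ring_scope.

(** The q-binomial formula writes [x^m / [m]!] as the [m]-th term of the Cauchy
    product of the series of [e_q^a] and [\sum_k (x-a)^k_q / [k]!], so
    [e_q^x = e_q^a \sum_k (x-a)^k_q / [k]!] for [0 <= a <= x]. The remainder
    after [n] terms, divided by [(x-a)^n_q], is a sum of nonnegative multiples
    of the products [(x - q^n a)...(x - q^(k-1) a)], hence nondecreasing in [x];
    the two bounds compare its value at [x] with those at [q^-1 a] and [b]. *)

Definition cauchy_prod (R : realType) (u v : R^nat) : R^nat :=
  fun m => \sum_(0 <= k < m.+1) u (m - k)%N * v k.

(** Sums over the triangle [j + k < N] by columns: [v k] meets exactly the [u j] with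
    [j < N - k]. *)
Lemma series_cauchy_prod (R : realType) (u v : R^nat) N :
  series (cauchy_prod u v) N = \sum_(0 <= k < N) v k * series u (N - k)%N.
Proof.
rewrite seriesEnat /=; elim: N => [|N IHN]; first by rewrite !big_geq.
rewrite big_nat_recr //= IHN /cauchy_prod !big_nat_recr //= addrA -big_split /=.
rewrite subnn subSnn; congr (_ + _); last first.
  by rewrite seriesEnat /= big_nat1 mulrC.
apply: eq_big_nat => k /andP[_ kN].
by rewrite subSn ?(ltnW kN)// !seriesEnat /= big_nat_recr //=; ring.
Qed.

Lemma lim_series_cauchy_prod (R : realType) (u v : R^nat) :
  (forall k, 0 <= u k) -> (forall k, 0 <= v k) ->
  cvgn (series u) -> cvgn (series v) -> cvgn (series (cauchy_prod u v)) ->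
  limn (series (cauchy_prod u v)) = limn (series u) * limn (series v).
Proof.
move=> u0 v0 cu cv cw.
have ndu := @nondecreasing_series R u xpredT 0%N (fun n _ _ => u0 n).
have cA : (fun N => series u N * series v N) @ \oo
    --> limn (series u) * limn (series v) by exact: cvgM.
have cC2 : (fun N => series (cauchy_prod u v) (N + N)%N) @ \oo
    --> limn (series (cauchy_prod u v)).
  apply: (@cvg_comp _ _ _ (fun N => (N + N)%N) (series (cauchy_prod u v)) _ \oo
    _ _ cw).
  move=> P [M _ MP]; exists M => //= k /= Mk.
  by apply: MP => /=; rewrite (leq_trans Mk) ?leq_addr.
rewrite -(cvg_lim _ cA) //; apply/esym/cvg_lim => //.
(* For partial sums C_N of the product, C_N <= A_N B_N <= C_{2N}. *)
apply: squeeze_cvgr cw cC2; near=> N.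
rewrite !series_cauchy_prod mulrC {1 2}[series v]seriesEnat /= mulr_suml.
apply/andP; split.
  apply: ler_sum_nat => k _; rewrite ler_wpM2l //.
  by apply: ndu; rewrite leq_subr.
rewrite [leRHS](big_cat_nat (n := N)) ?leq_addr //=.
rewrite -[leLHS]addr0 lerD ?sumr_ge0 // => [|k _]; last first.
  by rewrite mulr_ge0 // seriesEnat sumr_ge0.
apply: ler_sum_nat => k /andP[_ kN]; rewrite ler_wpM2l //.
by apply: ndu; rewrite -addnBA ?(ltnW kN)// leq_addr.
Unshelve. all: by end_near. Qed.

Lemma qnum_nat (R : realType) (q : R) k : 0 < q ->
  qnum q k%:R = (q ^+ k - 1) / (q - 1).
Proof. by move=> q0; rewrite /qnum powR_mulrn // ltW. Qed.

Lemma qnum_gt0 (R : realType) (q : R) k : 0 < q -> q < 1 -> 0 < qnum q k.+1%:R.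
Proof.
move=> q0 q1; rewrite qnum_nat // -mulrNN -invrN !opprB divr_gt0 ?subr_gt0 //.
by rewrite exprn_ilt1 // ltW.
Qed.

Lemma qnumD (R : realType) (q : R) k j : 0 < q ->
  qnum q (k + j)%:R = qnum q k%:R + q ^+ k * qnum q j%:R.
Proof. by move=> q0; rewrite !qnum_nat // exprD; ring. Qed.

Lemma qfact0 (R : realType) (q : R) : qfact q 0 = 1.
Proof. by rewrite /qfact big_geq. Qed.

Lemma qfactS (R : realType) (q : R) k :
  qfact q k.+1 = qfact q k * qnum q k.+1%:R.
Proof. by rewrite /qfact big_nat_recr. Qed.

Lemma qfact_gt0 (R : realType) (q : R) k : 0 < q -> q < 1 -> 0 < qfact q k.
Proof.
move=> q0 q1; elim: k => [|k IHk]; first by rewrite qfact0.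
by rewrite qfactS mulr_gt0 ?qnum_gt0.
Qed.

Lemma qpowS (R : realType) (q x a : R) k :
  qpow q x a k.+1 = qpow q x a k * (x - q ^+ k * a).
Proof. by rewrite /qpow big_nat_recr. Qed.

(** Multiplied by [qexp q a], these are the terms of the q-Taylor series of the q-exponential at
    [a]. *)
Definition qpow_term (R : realType) (q x a : R) : R^nat :=
  fun k => qpow q x a k / qfact q k.

(** The q-binomial formula divided by [[m]!]. Both sides equal 1 at [m = 0] and satisfy [[m+1]
    t_(m+1) = x t_m]. *)
Lemma qexp_term_cauchy_prod (R : realType) (q x a : R) : 0 < q -> q < 1 ->
  cauchy_prod (qexp_term q a) (qpow_term q x a) = qexp_term q x.
Proof.
move=> q0 q1; apply/funext => m; elim: m => [|m IHm].
  by rewrite /cauchy_prod big_nat1 /qexp_term /qpow_term /qpow big_geq // !expr0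
    qfact0 divr1 mulr1.
have qn0 k : qnum q k.+1%:R != 0 by rewrite gt_eqF ?qnum_gt0.
have qf0 k : qfact q k != 0 by rewrite gt_eqF ?qfact_gt0.
have qn00 : qnum q 0%:R = 0 :> R by rewrite qnum_nat // expr0 subrr mul0r.
have expS y k : qnum q k.+1%:R * qexp_term q y k.+1 = y * qexp_term q y k.
  by rewrite /qexp_term qfactS exprS; field; rewrite qn0 qf0.
have powS k : qnum q k.+1%:R * qpow_term q x a k.+1
    = (x - q ^+ k * a) * qpow_term q x a k.
  by rewrite /qpow_term qfactS qpowS; field; rewrite qn0 qf0.
apply: (mulfI (qn0 m)); rewrite expS -IHm /cauchy_prod !mulr_sumr.
(* Split [m+1] as [k] + q^k [m+1-k]: the first part lowers the index of
   (x-a)^k, the second one that of a^(m+1-k). *)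
rewrite (eq_big_nat _ _ (F2 := fun k =>
    qexp_term q a (m.+1 - k)%N * (qnum q k%:R * qpow_term q x a k)
  + q ^+ k * (qnum q (m.+1 - k)%:R * qexp_term q a (m.+1 - k)%N)
    * qpow_term q x a k)); last first.
  move=> k /andP[_ km].
  by rewrite -{1}(subnKC (km : (k <= m.+1)%N)) qnumD //; ring.
(* Since [[0] = 0], the first part loses its term [k = 0] and the second its term [k = m+1]. After
   reindexing, the factors [x - q^k a] and [q^k a] add up to [x]. *)
rewrite big_split /= big_nat_recl // qn00 mul0r mulr0 add0r.
rewrite [X in _ + X]big_nat_recr //= subnn qn00 mul0r mulr0 mul0r addr0.
rewrite -big_split /=; apply: eq_big_nat => k /andP[_ km].
by rewrite powS subSS subSn // expS; ring.
Qed.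

Lemma qexp_term_ge0 (R : realType) (q x : R) k : 0 < q -> q < 1 -> 0 <= x ->
  0 <= qexp_term q x k.
Proof. by move=> *; rewrite divr_ge0 ?exprn_ge0 // ltW ?qfact_gt0. Qed.

(** Termwise comparison; it carries the convergence assumed at [b] down to [x] and [a]. *)
Lemma cvg_qexp_le (R : realType) (q x y : R) : 0 < q -> q < 1 ->
  0 <= x -> x <= y -> cvgn (series (qexp_term q y)) ->
  cvgn (series (qexp_term q x)).
Proof.
move=> q0 q1 x0 xy; apply: series_le_cvg => k; rewrite ?qexp_term_ge0 //.
  exact: le_trans xy.
by rewrite ler_wpM2r ?invr_ge0 ?lerXn2r ?nnegrE ?(le_trans x0 xy)//
  ltW ?qfact_gt0.
Qed.

Lemma subr_qXM_ge0 (R : realType) (q a x : R) k : 0 <= q -> q <= 1 ->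
  0 <= a -> a <= x -> 0 <= x - q ^+ k * a.
Proof.
by move=> q0 q1 a0 ax; rewrite subr_ge0 (le_trans _ ax) // ler_piMl // exprn_ile1.
Qed.

Lemma qpow_ge0 (R : realType) (q a x : R) k : 0 <= q -> q <= 1 ->
  0 <= a -> a <= x -> 0 <= qpow q x a k.
Proof. by move=> *; apply: prodr_ge0 => j _; exact: subr_qXM_ge0. Qed.

Lemma qpow_gt0 (R : realType) (q a x : R) k : 0 <= q -> q <= 1 ->
  0 <= a -> a < x -> 0 < qpow q x a k.
Proof.
move=> q0 q1 a0 ax; apply: prodr_gt0 => j _.
by rewrite subr_gt0 (le_lt_trans _ ax) // ler_piMl // exprn_ile1.
Qed.

Lemma qpow_term_ge0 (R : realType) (q a x : R) k : 0 < q -> q < 1 ->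
  0 <= a -> a <= x -> 0 <= qpow_term q x a k.
Proof.
by move=> q0 q1 a0 ax; rewrite divr_ge0 ?(qpow_ge0 _ (ltW q0) (ltW q1))// ltW
  ?qfact_gt0.
Qed.

(** By the q-binomial formula [x^k / [k]!] is a sum of nonnegative terms, the last of which is
    [qpow_term q x a k]; so the series of the q-exponential at [x] dominates. *)
Lemma cvg_qpow_series (R : realType) (q a x : R) : 0 < q -> q < 1 ->
  0 <= a -> a <= x -> cvgn (series (qexp_term q x)) ->
  cvgn (series (qpow_term q x a)).
Proof.
move=> q0 q1 a0 ax; apply: series_le_cvg => k.
- exact: qpow_term_ge0.
- by rewrite qexp_term_ge0 // (le_trans a0).
rewrite -(qexp_term_cauchy_prod x a q0 q1) /cauchy_prod big_nat_recr //= subnn.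
rewrite {2}/qexp_term expr0 qfact0 divr1 mul1r lerDr sumr_ge0 // => j _.
by rewrite mulr_ge0 ?qexp_term_ge0 ?qpow_term_ge0.
Qed.

Lemma qexp_qpow_series (R : realType) (q a x : R) : 0 < q -> q < 1 ->
  0 <= a -> a <= x -> cvgn (series (qexp_term q x)) ->
  qexp q x = qexp q a * limn (series (qpow_term q x a)).
Proof.
move=> q0 q1 a0 ax cx; rewrite /qexp -(qexp_term_cauchy_prod x a q0 q1).
rewrite lim_series_cauchy_prod ?qexp_term_cauchy_prod //.
- by move=> k; rewrite qexp_term_ge0.
- by move=> k; rewrite qpow_term_ge0.
- exact: cvg_qexp_le cx.
- exact: cvg_qpow_series.
Qed.

(* The quotient (x-a)^k_q / (x-a)^n_q is nondecreasing in x, cross-multiplied to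
   include the degenerate case x = a. *)
Lemma qpow_leM (R : realType) (q a x y : R) n k : 0 <= q -> q <= 1 ->
  0 <= a -> a <= x -> x <= y -> (n <= k)%N ->
  qpow q x a k * qpow q y a n <= qpow q y a k * qpow q x a n.
Proof.
move=> q0 q1 a0 ax xy /subnKC <-; elim: (k - n)%N => [|d IHd].
  by rewrite addn0 mulrC.
rewrite addnS !qpowS ![_ * (_ - _) * _]mulrAC.
have ay := le_trans ax xy.
by rewrite ler_pM ?mulr_ge0 ?qpow_ge0 ?subr_qXM_ge0 ?lerB.
Qed.

(** Monotonicity of the remainder divided by [(x-a)^n_q], with denominators cleared. After the
    factor [qexp q a >= 0] is removed, each remainder is a limit of sums over [n <= k < N], which
    [qpow_leM] compares term by term. *)
Lemma qexp_qpow_rem_leM (R : realType) (q a x y : R) n : 0 < q -> q < 1 ->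
  0 <= a -> a <= x -> x <= y -> cvgn (series (qexp_term q y)) ->
  (qexp q x - \sum_(0 <= k < n) qexp q a / qfact q k * qpow q x a k)
    * qpow q y a n
  <= (qexp q y - \sum_(0 <= k < n) qexp q a / qfact q k * qpow q y a k)
    * qpow q x a n.
Proof.
move=> q0 q1 a0 ax xy cy; have ay := le_trans ax xy.
have cx := cvg_qexp_le q0 q1 (le_trans a0 ax) xy cy.
have sumE z : \sum_(0 <= k < n) qexp q a / qfact q k * qpow q z a k
    = qexp q a * series (qpow_term q z a) n.
  by rewrite seriesEnat /= mulr_sumr; apply: eq_bigr => k _; rewrite mulrAC -mulrA.
have ea0 : 0 <= qexp q a.
  have ca := cvg_qexp_le q0 q1 a0 ay cy.
  rewrite /qexp; apply: (limr_ge ca); near=> N.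
  by rewrite seriesEnat sumr_ge0 // => k _; rewrite qexp_term_ge0.
rewrite !sumE (qexp_qpow_series q0 q1 a0 ax cx) (qexp_qpow_series q0 q1 a0 ay cy).
rewrite -!mulrBr -!mulrA ler_wpM2l //.
have cvgr z c : cvgn (series (qpow_term q z a)) ->
    (fun N => (series (qpow_term q z a) N - series (qpow_term q z a) n) * c) @ \oo
    --> (limn (series (qpow_term q z a)) - series (qpow_term q z a) n) * c.
  by move=> cz; apply: cvgMr_tmp; apply: cvgB; [exact: cz|exact: cvg_cst].
apply: (ler_cvg_to (cvgr _ _ (cvg_qpow_series q0 q1 a0 ax cx))
  (cvgr _ _ (cvg_qpow_series q0 q1 a0 ay cy))).
near=> N.
have nN : (n <= N)%N by near: N; exact: nbhs_infty_ge.
rewrite !sub_series_geq // !mulr_suml; apply: ler_sum_nat => k /andP[nk _].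
rewrite ![_ / _ * _]mulrAC ler_wpM2r ?invr_ge0 ?(ltW (qfact_gt0 _ q0 q1))//.
by rewrite qpow_leM // ltW.
Unshelve. all: by end_near. Qed.

Theorem theorem3p1 (R : realType) (q a b : R) (n : nat)
    (hq0 : 0 < q) (hq1 : q < 1)
    (ha : a \in qZ q) (hb : b \in qZ q) (hab : a < b) (hn : (0 < n)%N)
    (hcvg : cvgn (series (qexp_term q b))) :
  forall x : R, x \in timescale_itv q (q^-1 * a) b ->
    qexp q x >=
      \sum_(0 <= k < n) qexp q a / qfact q k * qpow q x a k
      + 1 / qpow q (q^-1 * a) a n
        * (qexp q (q^-1 * a)
           - \sum_(0 <= k < n) qexp q a / qfact q k * qpow q (q^-1 * a) a k)
        * qpow q x a n
    /\
    qexp q x <=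
      \sum_(0 <= k < n) qexp q a / qfact q k * qpow q x a k
      + 1 / qpow q b a n
        * (qexp q b
           - \sum_(0 <= k < n) qexp q a / qfact q k * qpow q b a k)
        * qpow q x a n.
Proof.
move=> x; rewrite inE => -[_ /andP[cx xb]].
move: ha; rewrite inE => -[m _ am].
have a0 : 0 < a by rewrite -am exprz_gt0.
(* The left end of the interval lies strictly above [a], so both denominators are positive. *)
have ac : a < q^-1 * a by rewrite ltr_pMl // invf_gt1.
have ax := lt_le_trans ac cx.
have [q0 q1] := (ltW hq0, ltW hq1).
have pos y : a < y -> 0 < qpow q y a n by move=> ay; rewrite qpow_gt0 // ltW.
have cvx := cvg_qexp_le hq0 hq1 (ltW (lt_trans a0 ax)) xb hcvg.
have coefE (u c E y : R) : 1 / u * (E - c) * y = (E - c) * y / u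
  by rewrite mul1r mulrC mulrCA mulrC [y * _]mulrC.
rewrite !coefE; split.
  (* The lower bound compares the remainders at [q^-1 * a <= x], the upper one those at [x <= b]. *)
  by rewrite -lerBrDl ler_pdivrMr ?pos // qexp_qpow_rem_leM // ltW.
by rewrite -lerBlDl ler_pdivlMr ?pos ?(lt_le_trans ax)// qexp_qpow_rem_leM // ltW.
Qed.
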